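(* There exists a function $f:\mathbb{Z}_{\geq 1}\times\mathbb{Z}_{\geq 1}\to\mathbb{Z}_{\geq 1}$ such that the following holds. Let $k$ and $n$ be positive integers and let $G$ be a group such that $|x|_k\leq n$ for every $x\in G$. Then $\gamma_{k+1}(G)$ is finite and $|\gamma_{k+1}(G)|\leq f(k,n)$.
   Context: For elements of a group, $[x,y]=x^{-1}y^{-1}xy$, and $[x_1,\dots,x_k]=[\dots[[x_1,x_2],x_3]\dots,x_k]$ denotes the left-normed commutator. For a group $G$, an element $a\in G$ and an integer $k\geq 1$, $|a|_k$ denotes the cardinality of the set $\{[a,x_1,\dots,x_k] : x_1,\dots,x_k\in G\}$. $\gamma_i(G)$ denotes the $i$th term of the lower central series of $G$ (with $\gamma_1(G)=G$), i.e. the subgroup generated by all commutators $[x_1,\dots,x_i]$ with $x_j\in G$. *)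

(* Defs.v *)
From mathcomp Require Import all_boot.
From mathcomp Require Import boolp classical_sets functions cardinality.

Set Implicit Arguments.
Unset Strict Implicit.
Unset Printing Implicit Defensive.

Local Open Scope classical_set_scope.
Local Open Scope group_scope.

(* [x_1, ..., x_k] for the sequence [:: x_1; ...; x_k]. MathComp's [~ x, y]
   unfolds to x^-1 * (y^-1 * (x * y)). The empty case is a dummy value. *)
Definition lnormed_commg (G : groupType) (s : seq G) : G :=
  if s is x :: s' then foldl (fun u v => [~ u, v]) x s' else 1.

Definition commg_values (G : groupType) (k : nat) (a : G) : set G :=
  [set lnormed_commg (a :: t) | t in [set: k.-tuple G]].

Definition generated_subgroup (G : groupType) (X : set G) : set G :=
  smallest (fun H : set G => group_closed (mem H)) X.

(* Meaningful for i >= 1 only; lower_central G 1 is all of G. *)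
Definition lower_central (G : groupType) (i : nat) : set G :=
  generated_subgroup [set lnormed_commg t | t in [set: i.-tuple G]].
Arguments lower_central G i : clear implicits.

(* Main.v *)
Require Import Defs.
From mathcomp Require Import all_boot.
From mathcomp Require Import boolp classical_sets functions cardinality.

(** For [u] in [G] let [V u] be the set of the values [[u, x_1, ..., x_k]], and
    let [N u] be its normal closure. The proof bounds the order of each [N u],
    then the order of the subgroup generated by all of them.

    Each [N u] is finite, of bounded order ([N_bounded]). A commutator [v] of
    weight [k] starting with [u] has at most [n] conjugates, because
    [v ^ y = v * [v, y]] and [[v, y]] is in [V u]. An element of [V u] is also a
    commutator of weight [k] starting with some [[u, x_1]]; hence these elements
    have at most [n * n] conjugates altogether, and by a counting argument of
    Dietzmann and Schur ([at_most_prods]) it is enough to bound their orders.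
    Write an element of [V u] as [[g, y]] with [g] of weight [k], and let [A] be
    generated by the conjugates of [g]. As [A] is central-by-finite, its derived
    subgroup is finite by Schur's theorem, so some power map [x |-> x ^+ M] is a
    morphism from [A] to its centre [Z] ([expg_transferM]). Thus [[g, y] ^+ M =
    [c, y]] with [c = g ^+ M] in [Z]. On [Z] the map [delta z = [z, y]] is an
    endomorphism, and [delta^k (c ^+ j)] belongs to the small set [V y] for
    every [j], so that [delta^k c] has finite order. Since [y] acts on [Z] as an
    automorphism of finite order, which cannot be unipotent modulo torsion
    without being trivial modulo torsion, [delta c] has finite order as well
    ([commg_torsion]).

    Modulo [N u], the element [u] lies in the [k]th term of the upper central
    series. Therefore [N u] contains every [[w, u, x_2, ..., x_k]] too
    ([N_second]), and modulo [N u] the values [[u * a, x_1, ..., x_k]] and [[a,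
    x_1, ..., x_k]] coincide ([upper_central_mul]). Choose [a] with [N a]
    maximal, and let [K] be the product of the [N x_1], where one tuple [(x_1,
    ..., x_k)] is kept for each element of [V a]. Suppose that [N u] meets [K]
    trivially. For each chosen tuple the two values above lie in [K], and their
    quotient lies in [N u], so they are equal. Hence [N a] is contained in
    [N (u * a)], and they are equal by maximality; so [a] and [u * a], and therefore
    [u], lie in the [k]th upper centre modulo [N a], whence [N u] is contained
    in [N a], which is contained in [K], and [N u] is trivial.

    So the bounded normal subgroup [K] meets every nontrivial [N u]
    nontrivially. The same argument relative to a given bounded normal subgroup
    replaces it by a larger one, whose intersection with each [N u] gains an
    element unless the larger subgroup contains [N u] ([enlarge]). Since the
    orders of the [N u] are bounded, boundedly many rounds yield a bounded
    normal subgroup that contains every [N u], hence [gamma_(k+1)(G)]. *)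

Set Implicit Arguments.
Unset Strict Implicit.
Unset Printing Implicit Defensive.

Local Open Scope classical_set_scope.
Local Open Scope group_scope.

(** * Sets of bounded size *)

Definition at_most (T : eqType) (n : nat) (X : set T) : Prop :=
  exists2 s : seq T, (size s <= n)%N & forall x, X x -> x \in s.

Section AtMost.
Variables T U : eqType.

Lemma at_most_sub (X Y : set T) a b :
  (a <= b)%N -> X `<=` Y -> at_most a Y -> at_most b X.
Proof.
move=> ab XY [s sa sY]; exists s; first exact: leq_trans sa ab.
by move=> x /XY /sY.
Qed.

Lemma at_most_bigcup (X : set T) (F : T -> set U) a b :
    at_most a X -> (forall x, X x -> at_most b (F x)) ->
  at_most (a * b) [set y | exists2 x, X x & F x y].
Proof.
move=> [s sa sX] Fb.
have /choice[L LP] (x : T) :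
    exists l : seq U, (size l <= b)%N /\ (X x -> forall y, F x y -> y \in l).
  case: (pselect (X x)) => [Xx|nXx]; last by exists [::].
  by have [l lb lF] := Fb x Xx; exists l.
exists (flatten (map L s)).
  apply: (@leq_trans (size s * b)); last by rewrite leq_mul2r sa orbT.
  elim: (s) => //= x l IH; rewrite size_cat mulSn leq_add //.
  by have [] := LP x.
move=> y [x Xx Fxy]; apply/flattenP; exists (L x); first exact/map_f/sX.
by have [_ /(_ Xx)] := LP x; apply.
Qed.

Lemma at_most_image (f : T -> U) (X : set T) a :
  at_most a X -> at_most a (f @` X).
Proof.
move=> [s sa sX]; exists (map f s); first by rewrite size_map.
by move=> _ [x /sX xs <-]; apply: map_f.
Qed.

Lemma at_most_uniq (X : set T) a (s : seq T) :
  at_most a X -> uniq s -> (forall x, x \in s -> X x) -> (size s <= a)%N.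
Proof.
move=> [l la lX] us sX; apply: leq_trans la.
by apply: uniq_leq_size => // x /sX /lX.
Qed.

Lemma pigeonhole (X : set T) a (f : nat -> T) :
    at_most a X -> (forall i, X (f i)) ->
  exists i j, [/\ (i < j)%N, (j <= a)%N & f i = f j].
Proof.
move=> aX fX; set s := mkseq f a.+1.
have /uniqPn -/(_ (f 0%N)) : ~~ uniq s.
  apply/negP => /(at_most_uniq aX); rewrite size_mkseq ltnn => H.
  by apply: (notF (H _)) => x /mapP[i _ ->].
move=> [i [j]]; rewrite size_mkseq => -[ij ja].
rewrite !nth_mkseq // ?(ltn_trans ij) // => eqf.
by exists i, j.
Qed.

(** Without a maximal member, one could always add an element to a list of
    distinct elements of some member, and such lists would grow beyond [a]. *)
Lemma maximal_exists (I : Type) (i0 : I) (F : I -> set T) a :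
    (forall i, at_most a (F i)) ->
  exists i, forall j, F i `<=` F j -> F j `<=` F i.
Proof.
move=> aF; apply/not_existsP => nmax.
have large b : exists (i : I) (s : seq T),
    [/\ uniq s, size s = b & forall x, x \in s -> F i x].
  elim: b => [|b [i [s [us sb sF]]]]; first by exists i0, [::].
  have /existsNP[j /not_implyP[Fij]] := nmax i.
  move=> /existsNP[x /not_implyP[Fjx nFix]].
  exists j, (x :: s); split => //=; rewrite ?sb ?us ?andbT //.
    by apply/negP => /sF.
  by move=> y; rewrite inE => /orP[/eqP->//|/sF /Fij].
have [i [s [us sb sF]]] := large a.+1.
by have := at_most_uniq (aF i) us sF; rewrite sb ltnn.
Qed.

End AtMost.

(** Bounds the number of values of an expression through a finite invariant that
    determines it; used for commutators, which depend only on the action of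
    their entries on a finite conjugacy class. *)
Lemma at_most_key (S : Type) (T : eqType) (K : finType) (X : set S)
    (key : S -> K) (f : S -> T) :
    (forall x y, X x -> X y -> key x = key y -> f x = f y) ->
  at_most #|K| (f @` X).
Proof.
move=> keyf.
have aK : at_most #|K| [set: K].
  by exists (enum K); [rewrite cardE | move=> c _; rewrite mem_enum].
pose F c := [set y | exists2 x, X x & key x = c /\ f x = y].
have aF c : [set: K] c -> at_most 1 (F c).
  move=> _; case: (pselect (exists2 x, X x & key x = c)) => [[x Xx xc]|nX].
    exists [:: f x] => // _ [y Xy [yc <-]].
    by rewrite inE (keyf y x) // xc yc.
  by exists [::] => // y [x Xx [xc _]]; case: nX; exists x.
apply: at_most_sub (at_most_bigcup aK aF); first by rewrite muln1.
by move=> _ [x Xx <-]; exists (key x) => //; exists x.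
Qed.

Lemma card_le_at_most (T : choiceType) (X : set T) a :
  (X #<= `I_a)%card -> at_most a X.
Proof.
move=> Xa.
have Xfin : finite_set X by apply: card_le_finite Xa (finite_II a).
have [b Xb] := Xfin.
exists (finmap.enum_fset (fset_set X)).
  rewrite (card_fset_set Xb).
  by move: Xa; rewrite (card_le_eql Xb) card_le_II.
by move=> x Xx; rewrite in_fset_set // mem_set.
Qed.

Lemma at_most_card_le (T : choiceType) (X : set T) a :
  at_most a X -> (X #<= `I_a)%card.
Proof.
move=> [s sa sX]; have [->|/set0P[x0 _]] := eqVneq X set0.
  exact: card_ge0.
apply: card_le_trans (card_image_le (nth x0 s) _).
apply: subset_card_le => x /sX xs; exists (index x s); last exact: nth_index.
by apply: leq_trans sa; rewrite index_mem.
Qed.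

(** * Subgroups and normal closures *)

Section Subgroups.
Variable G : groupType.
Implicit Types (H X : set G) (x y z : G).

Definition subgroup H : Prop := H 1 /\ forall x y, H x -> H y -> H (x / y).

Lemma subgroupE H : subgroup H <-> group_closed (mem H).
Proof.
split=> -[H1 HB]; split=> [|x y Hx Hy].
- exact: mem_set.
- by apply/mem_set/HB; apply: set_mem.
- exact: set_mem H1.
- by apply: set_mem; apply: HB; apply: mem_set.
Qed.

Lemma subgroupV H x : subgroup H -> H x -> H x^-1.
Proof. by move=> [H1 HB] Hx; rewrite -[x^-1]mul1g; apply: HB. Qed.

Lemma subgroupM H x y : subgroup H -> H x -> H y -> H (x * y).
Proof.
by move=> sH Hx Hy; rewrite -[y]invgK; apply: sH.2 => //; apply: subgroupV.
Qed.

Lemma subgroupX H x n : subgroup H -> H x -> H (x ^+ n).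
Proof.
move=> sH Hx; elim: n => [|n IH]; first exact: sH.1.
by rewrite expgS; apply: subgroupM.
Qed.

Definition normal H : Prop := subgroup H /\ forall x y, H x -> H (x ^ y).

Lemma normal_commg H x y : normal H -> H x -> H [~ x, y].
Proof.
move=> [sH nH] Hx; apply: subgroupM => //; first exact: subgroupV.
exact: nH.
Qed.

Lemma gen_sub X : X `<=` generated_subgroup X.
Proof. exact: sub_gen_smallest. Qed.

Lemma gen_min X H : subgroup H -> X `<=` H -> generated_subgroup X `<=` H.
Proof. by move=> /(subgroupE H).1 sH XH; apply: smallest_sub. Qed.

Lemma gen_subgroup X : subgroup (generated_subgroup X).
Proof.
split; first by move=> H [/(subgroupE H).2 sH _]; exact: sH.1.
move=> x y gx gy H [/(subgroupE H).2 sH XH].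
by apply: sH.2; [apply: gx|apply: gy]; split=> //; exact: (subgroupE H).1.
Qed.

Lemma gen_normal X :
  (forall x y, X x -> X (x ^ y)) -> normal (generated_subgroup X).
Proof.
move=> XJ; split=> [|x y]; first exact: gen_subgroup.
apply: (@gen_min X [set x | generated_subgroup X (x ^ y)]) => [|{}x Xx].
  split=> [|u v gu gv].
    by rewrite /mkset conj1g; exact: (gen_subgroup X).1.
  by rewrite /mkset conjMg conjVg; apply: (gen_subgroup X).2.
by apply: gen_sub; apply: XJ.
Qed.

Lemma gen_commute X z :
  (forall x, X x -> commute z x) ->
  forall x, generated_subgroup X x -> commute z x.
Proof.
move=> zX; apply: (@gen_min X [set x | commute z x]) => //.
split=> [|x y zx zy]; first exact: commute1.
by apply: commuteM => //; apply: commuteV.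
Qed.

Definition normal_closure X : set G :=
  generated_subgroup [set x | exists2 v, X v & exists y, x = v ^ y].

Lemma normal_closure_normal X : normal (normal_closure X).
Proof.
apply: gen_normal => _ y [v Xv [z ->]]; exists v => //.
by exists (z * y); rewrite conjgM.
Qed.

Lemma normal_closure_sub X : X `<=` normal_closure X.
Proof.
by move=> x Xx; apply: gen_sub; exists x => //; exists 1; rewrite conjg1.
Qed.

Lemma normal_closure_min X H : normal H -> X `<=` H -> normal_closure X `<=` H.
Proof.
by move=> [sH nH] XH; apply: gen_min => // _ [v /XH Hv [y ->]]; apply: nH.
Qed.

(** The product set [H * K], membership being tested on the cofactor in [K]. *)
Definition join H K : set G := [set z | exists2 x, H x & K (x^-1 * z)].

Lemma join_normal H K : normal H -> normal K -> normal (join H K).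
Proof.
move=> nH nK; have [sH HJ] := nH; have [sK KJ] := nK; split; first split.
- by exists 1; [exact: sH.1 | rewrite invg1 mul1g; exact: sK.1].
- move=> z w [x Hx Kz] [y Hy Kw]; exists (x / y); first exact: sH.2.
  have -> : (x / y)^-1 * (z / w) = (x^-1 * z / (y^-1 * w)) ^ y^-1.
    by rewrite /conjg !invgM !invgK !mulgA mulgK.
  by apply: KJ; apply: sK.2.
- move=> z y [x Hx Kz]; exists (x ^ y); first exact: HJ.
  by rewrite -conjVg -conjMg; apply: KJ.
Qed.

Lemma join_subl H K : subgroup K -> H `<=` join H K.
Proof. by move=> sK x Hx; exists x => //; rewrite mulVg; exact: sK.1. Qed.

Lemma join_subr H K : subgroup H -> K `<=` join H K.
Proof. by move=> sH x Kx; exists 1; [exact: sH.1 | rewrite invg1 mul1g]. Qed.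

Lemma join_min H K L : subgroup L -> H `<=` L -> K `<=` L -> join H K `<=` L.
Proof.
by move=> sL HL KL z [x /HL Lx /KL Lz]; rewrite -(mulVKg x z); apply: subgroupM.
Qed.

Lemma at_most_join H K a b :
  at_most a H -> at_most b K -> at_most (a * b)%N (join H K).
Proof.
move=> aH bK; apply: at_most_bigcup aH _ => x _.
apply: at_most_sub (at_most_image (fun y => x * y) bK) => // z Kz.
by exists (x^-1 * z) => //; rewrite mulVKg.
Qed.

End Subgroups.

(** * Elements with few powers or few conjugates *)

Section Orders.
Variable G : groupType.
Implicit Types (X : set G) (x y : G).

Lemma expg_fact_eq1 X a x :
  at_most a X -> (forall i, X (x ^+ i)) -> x ^+ a`! = 1.
Proof.
move=> aX xX; have [i [j [ij ja]]] := pigeonhole aX xX.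
rewrite -{1}(subnKC (ltnW ij)) expgnDr -{1}[x ^+ i]mulg1 => /mulgI/esym xd.
have /dvdnP[q ->] : (j - i %| a`!)%N.
  by apply: dvdn_fact; rewrite subn_gt0 ij (leq_trans (leq_subr _ _)).
by rewrite mulnC expgnA xd expg1n.
Qed.

Lemma commute_expg_fact X a x y :
  at_most a X -> (forall z, X (x ^ z)) -> commute x (y ^+ a`!).
Proof.
move=> aX xX; have [i [j [ij ja]]] := pigeonhole aX (fun i => xX (y ^+ i)).
rewrite -{1}(subnK (ltnW ij)) expgnDr conjgM.
move=> /conjg_inj/esym/conjg_fixP/commgP xd.
have /dvdnP[q ->] : (j - i %| a`!)%N.
  by apply: dvdn_fact; rewrite subn_gt0 ij (leq_trans (leq_subr _ _)).
by rewrite mulnC expgnA; apply: commuteX.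
Qed.

End Orders.

(** * The counting argument of Dietzmann and Schur *)

Section Products.
Variables (G : groupType) (T : set G).
Implicit Types (c d x : G) (s : seq G).

Definition all_in s : Prop := forall c, c \in s -> T c.

Definition prods : set G :=
  [set x | exists2 s, all_in s & x = \prod_(c <- s) c].

Lemma all_in_cons c s : all_in (c :: s) <-> T c /\ all_in s.
Proof.
split=> [Ts|[Tc Ts] d]; last by rewrite inE => /orP[/eqP->|/Ts].
by split=> [|d ds]; apply: Ts; rewrite inE ?eqxx // ds orbT.
Qed.

Lemma all_in_cat s1 s2 : all_in s1 -> all_in s2 -> all_in (s1 ++ s2).
Proof. by move=> T1 T2 d; rewrite mem_cat => /orP[/T1|/T2]. Qed.

Lemma prods1 : prods 1.
Proof. by exists [::] => //; rewrite big_nil. Qed.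

Lemma prodsM x y : prods x -> prods y -> prods (x * y).
Proof.
move=> [s Ts ->] [t Tt ->]; exists (s ++ t); first exact: all_in_cat.
by rewrite big_cat.
Qed.

Lemma sub_prods : T `<=` prods.
Proof.
by move=> c Tc; exists [:: c]; [apply/all_in_cons | rewrite big_seq1].
Qed.

Lemma prodsX x j : prods x -> prods (x ^+ j).
Proof.
by move=> Px; elim: j => [|j IH]; [exact: prods1 | rewrite expgS; exact: prodsM].
Qed.

Lemma prods_conj x y :
  (forall c, T c -> T (c ^ y)) -> prods x -> prods (x ^ y).
Proof.
move=> TJ [s Ts ->]; exists [seq c ^ y | c <- s].
  by move=> _ /mapP[c /Ts Tc ->]; exact: TJ.
by rewrite conjg_prod big_map.
Qed.

(** A word of length at most [l] is a word of length exactly [l] in the alphabet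
    enlarged by [1]. *)
Lemma at_most_short_prods p l : at_most p T ->
  at_most (p.+1 ^ l)%N
    [set x | exists2 s, all_in s /\ (size s <= l)%N & x = \prod_(c <- s) c].
Proof.
move=> aT.
have aT1 : at_most p.+1 (T `|` [set 1]).
  have [s sp sT] := aT; exists (1 :: s) => // c [/sT|->]; rewrite inE ?eqxx //.
  by move=> ->; rewrite orbT.
elim: l => [|l IH].
  exists [:: 1] => // x [s [_]]; rewrite leqn0 => /nilP-> ->.
  by rewrite big_nil mem_seq1.
have := at_most_bigcup aT1 (fun c _ => at_most_image (fun x => c * x) IH).
rewrite -expnS; apply: at_most_sub => // x [[|c s] [Ts sl] ->].
  exists 1; first by right.
  by exists 1; [exists [::]; rewrite ?big_nil | rewrite mul1g big_nil].
have [Tc {}Ts] := (all_in_cons c s).1 Ts.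
exists c; first by left.
by exists (\prod_(d <- s) d); [exists s | rewrite big_cons].
Qed.

Hypothesis TJ : forall c d, T c -> T d -> T (c ^ d).

(** Moving an occurrence of [c] to the left replaces the letters it passes by
    their conjugates, which are again letters. *)
Lemma collect_letter c j s :
    T c -> all_in s -> (j <= count_mem c s)%N ->
  exists s', [/\ all_in s', \prod_(d <- s) d = c ^+ j * \prod_(d <- s') d
                & size s = (j + size s')%N].
Proof.
move=> Tc; elim: s j => [|x s IH] j.
  by move=> _; rewrite leqn0 => /eqP->; exists [::]; rewrite big_nil mulg1.
case: j => [|j] Ts; first by exists (x :: s); rewrite mul1g.
have [Tx {}Ts] := (all_in_cons x s).1 Ts.
rewrite /=; case: eqP => [->|_]; rewrite ?add1n ?add0n.
  rewrite ltnS => /(IH _ Ts)[s' [Ts' es ss]]; exists s'; split => //.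
    by rewrite big_cons es expgS mulgA.
  by rewrite ss.
move=> /(IH _ Ts)[s' [Ts' es ss]]; exists (x ^ (c ^+ j.+1) :: s'); split.
- apply: (all_in_cons _ _).2; split => //.
  elim: j.+1 => [|i IHi]; first by rewrite expg0 conjg1.
  by rewrite expgSr conjgM; exact: TJ.
- by rewrite !big_cons es !mulgA mulgV mul1g.
- by rewrite /= ss addnS.
Qed.

Lemma frequent_letter (D s : seq G) e :
    {subset s <= D} -> (size D * e < size s)%N ->
  exists2 c, c \in s & (e <= count_mem c s)%N.
Proof.
move=> sD big_s; apply/not_exists2P => rare.
have : (size s <= \sum_(c <- D) count_mem c s)%N.
  elim: (s) sD => [|x l IH] lD; first by rewrite big1.
  rewrite /= big_split /= -add1n leq_add //; last first.
    by apply: IH => y yl; apply: lD; rewrite inE yl orbT.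
  rewrite (big_rem x) /= ?eqxx //; exact/lD/mem_head.
apply/negP; rewrite -ltnNge; apply: leq_ltn_trans big_s.
rewrite mulnC -count_predT -iter_addn_0 -big_const_seq; apply: leq_sum => c _.
case: (rare c) => [|/negP]; last by rewrite -ltnNge => /ltnW.
by move=> /negP/count_memPn->.
Qed.

Variables (p e : nat).
Hypothesis aT : at_most p T.
Hypothesis short_power : forall c, T c ->
  exists2 s, all_in s /\ (size s < e)%N & c ^+ e = \prod_(d <- s) d.

(** In a long word some letter [c] occurs [e] times. Collecting these occurrences
    into [c ^+ e] and replacing this power by fewer than [e] letters shortens the
    word, so words of length at most [p * e] represent all products. Dietzmann's
    lemma is the case where [c ^+ e] is the empty product; Schur's theorem is the
    case of commutators in a central-by-finite group. *)
Lemma at_most_prods : at_most (p.+1 ^ (p * e))%N prods.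
Proof.
have [D Dp DT] := aT.
apply: at_most_sub (at_most_short_prods (p * e)%N aT) => // _ [s Ts ->].
have [l] := ubnP (size s); elim: l s Ts => // l IH s Ts; rewrite ltnS => sl.
have [|big_s] := leqP (size s) (p * e)%N; first by exists s.
have sD : {subset s <= D} by move=> c /Ts /DT.
have [|c /Ts Tc] := @frequent_letter D s e sD.
  by apply: leq_ltn_trans big_s; rewrite leq_mul2r Dp orbT.
move=> /(collect_letter Tc Ts)[s' [Ts' -> ss]].
have [r [Tr re] ->] := short_power Tc.
have [||t Tt et] := IH (r ++ s') => //; first exact: all_in_cat.
  by apply: leq_trans sl; rewrite ss size_cat ltn_add2r.
by exists t => //; rewrite -et big_cat.
Qed.

End Products.

Arguments all_in_cons {G T} c s.

Lemma prods_subgroup (G : groupType) (T : set G) e :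
  (0 < e)%N -> (forall c, T c -> c ^+ e = 1) -> subgroup (prods T).
Proof.
move=> e0 Te; split=> [|x _ Px [s Ts ->]]; first exact: prods1.
apply: prodsM => //; elim: s Ts => [|c s IH].
  by rewrite big_nil invg1 => _; exact: prods1.
move=> /all_in_cons[Tc /IH Ps]; rewrite big_cons invgM; apply: prodsM => //.
have -> : c^-1 = c ^+ e.-1 by apply: mulg1_eq; rewrite -expgS prednK // Te.
by apply: prodsX; apply: sub_prods.
Qed.

(** * Torsion of commutators with an element that has few conjugates *)

Definition comm_bound n : nat := (n.+1 ^ n * n.+1 ^ n)%N.
Definition derived_bound n : nat :=
  ((comm_bound n).+1 ^ (comm_bound n * n`!.+1))%N.
Definition transfer_exp n : nat := (n`! * (derived_bound n)`!)%N.

Section FiniteClass.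
Variables (G : groupType) (g : G) (n : nat).
Let D : set G := [set g ^ y | y in [set: G]].
Hypothesis Dn : at_most n D.
Let A : set G := generated_subgroup D.

Let A_normal : normal A.
Proof. by apply: gen_normal => _ y [z _ <-]; exists (z * y); rewrite ?conjgM. Qed.

Let A_subgroup : subgroup A := A_normal.1.

Let A_conj y : A (g ^ y).
Proof. by apply: gen_sub; exists y. Qed.

Let A_g : A g.
Proof. by have := A_conj 1; rewrite conjg1. Qed.

Let fact_gt0 : (0 < n`!)%N := fact_gt0 n.

(** Every [y] permutes the at most [n] conjugates of [g], and its [n`!]-th power
    fixes each of them. *)
Let power_central x y : A x -> commute (y ^+ n`!) x.
Proof.
apply: gen_commute => {}x [z _ <-]; apply/commute_sym.
by apply: commute_expg_fact Dn _ => w; exists (z * w); rewrite ?conjgM.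
Qed.

Let comms : set G := [set [~ p.1, p.2] | p in A `*` A].

(** Two elements of [A] that act in the same way on the conjugates of [g] differ
    by a central element of [A], so they have the same commutators. The index
    [size s] is a possible value for entries of [s] that are not conjugates of
    [g], hence the codomain ['I_n.+1]. *)
Let comms_bounded : at_most (comm_bound n) comms.
Proof.
have [s sn sD] := Dn.
pose key x := [ffun i : 'I_n => inord (index (nth 1 s i ^ x) s) : 'I_n.+1].
have key_conj x y d : key x = key y -> A d -> d ^ x = d ^ y.
  move=> exy Ad; suff : commute (x / y) d.
    move=> /commute_sym/commgP/conjg_fixP/(congr1 (fun z => z ^ y)).
    by rewrite -conjgM mulgVK.
  apply: gen_commute Ad => {}d [w _ <-]; apply/commute_sym/commgP/conjg_fixP.
  rewrite conjgM; apply: (canLR (conjgK _)).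
  have ds z : (g ^ w) ^ z \in s.
    by apply: sD; exists (w * z); rewrite ?conjgM.
  have ws : g ^ w \in s by rewrite -[g ^ w]conjg1.
  have wn : index (g ^ w) s < n by apply: leq_trans sn; rewrite index_mem.
  move/ffunP: exy => /(_ (Ordinal wn)); rewrite !ffunE /= nth_index //.
  move=> /(congr1 val) /=; rewrite !inordK ?ltnS ?(leq_trans (index_size _ _)) //.
  by move=> e; rewrite -(nth_index 1 (ds x)) e nth_index.
pose K := ({ffun 'I_n -> 'I_n.+1} * {ffun 'I_n -> 'I_n.+1})%type.
have -> : comm_bound n = #|{: K}|.
  by rewrite card_prod !card_ffun !card_ord.
apply: (@at_most_key _ _ _ (A `*` A) (fun p => (key p.1, key p.2) : K)
  (fun p : G * G => [~ p.1, p.2])) => -[x z] [y w] /= [Ax Az] [Ay Aw] [kx kz].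
rewrite commgEl (key_conj z w x) // -commgEl.
by rewrite !commgEr (key_conj x y w^-1) //; exact: (subgroupV A_subgroup).
Qed.

Let commsJ c y : comms c -> comms (c ^ y).
Proof.
move=> [[x z] [Ax Az] <-]; exists (x ^ y, z ^ y); last by rewrite conjRg.
by split; apply: A_normal.2.
Qed.

(** The identity behind Schur's theorem: for [c = [x, z]] and [m = n`!], the power
    [c ^+ m] is central in [A], so
    [c ^+ m.+1 = c * (c ^+ m) ^ z = (c * c ^ z) * (c ^ z) ^+ m.-1], where
    [c * c ^ z = [x, z ^+ 2]] and [c ^ z = [x ^ z, z]]. *)
Let comms_power c : comms c ->
  exists2 s, all_in comms s /\ (size s < n`!.+1)%N
           & c ^+ n`!.+1 = \prod_(d <- s) d.
Proof.
move=> [[x z] [/= Ax Az] <-].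
exists ([~ x, z ^+ 2] :: nseq n`!.-1 [~ x ^ z, z]).
  split; last by rewrite /= size_nseq prednK.
  apply: (all_in_cons _ _).2; split.
    by exists (x, z ^+ 2) => //; split => //; exact: (subgroupX _ A_subgroup).
  move=> d; rewrite mem_nseq => /andP[_ /eqP->].
  by exists (x ^ z, z) => //; split => //; apply: A_normal.2.
rewrite big_cons big_nseq iter_mulg_1.
have -> : [~ x, z ^+ 2] = [~ x, z] * [~ x, z] ^ z.
  by rewrite expg2 !commgEl conjMg conjVg conjgM -[RHS]mulgA mulVKg.
have -> : [~ x ^ z, z] = [~ x, z] ^ z.
  by rewrite conjRg [z ^ z]conjgE mulKg.
rewrite -mulgA -expgS prednK // expgS; congr (_ * _); rewrite -conjXg.
by apply/esym/conjg_fixP/commgP; apply: power_central.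
Qed.

Let derived_exponent d : prods comms d -> d ^+ (derived_bound n)`! = 1.
Proof.
move=> Pd; apply: (@expg_fact_eq1 _ (prods comms)).
  by apply: at_most_prods comms_bounded comms_power => c d'; move=> /commsJ.
by move=> i; apply: prodsX.
Qed.

Let mul_expg x z j : A x -> A z ->
  exists2 d, prods comms d & (x * z) ^+ j = x ^+ j * z ^+ j * d.
Proof.
move=> Ax Az; elim: j => [|j [d Pd IH]].
  by exists 1; rewrite ?expg0 ?mulg1 //; exact: prods1.
have PJ w y : prods comms w -> prods comms (w ^ y).
  by apply: prods_conj => c; apply: commsJ.
exists ([~ z ^+ j, x] ^ z * d ^ (x * z)).
  apply: prodsM; last exact: PJ.
  apply: PJ; apply: sub_prods; exists (z ^+ j, x) => //.
  by split => //; exact: (subgroupX _ A_subgroup).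
(* The letters [x] and [z] of the last factor are moved to the left; the
   commutator created in passing stays in [prods comms]. *)
have swap : z ^+ j * (x * z) = x * (z ^+ j * z) * [~ z ^+ j, x] ^ z.
  rewrite mulgA (commgC (z ^+ j) x).
  rewrite -(mulgA _ [~ z ^+ j, x]) (conjgC [~ z ^+ j, x]).
  move: ([~ z ^+ j, x] ^ z) => w.
  by rewrite !mulgA.
rewrite expgSr IH -[LHS]mulgA (conjgC d) !expgSr.
move: (d ^ (x * z)) => d'; rewrite mulgA -(mulgA (x ^+ j)) swap.
by move: ([~ z ^+ j, x] ^ z) => w; rewrite !mulgA.
Qed.

Let M := transfer_exp n.

(** A substitute for the transfer into the centre: after raising to the power
    [n`!] the error term [d] is a quotient of central elements, and the second
    factor of [M] kills it. *)
Let expg_transferM x z : A x -> A z -> (x * z) ^+ M = x ^+ M * z ^+ M.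
Proof.
move=> Ax Az; have [d Pd xz] := mul_expg n`! Ax Az.
have Ad : A d.
  have := subgroupM A_subgroup (subgroupX n`! A_subgroup Ax)
            (subgroupX n`! A_subgroup Az).
  move=> Axz; rewrite -(mulKg (x ^+ n`! * z ^+ n`!) d) -xz.
  apply: (subgroupM A_subgroup); first exact: (subgroupV A_subgroup).
  by apply: (subgroupX _ A_subgroup); exact: (subgroupM A_subgroup).
rewrite /M !expgnA xz expgMn; last first.
  apply/commute_sym/commuteM; apply/commute_sym; exact: power_central.
rewrite (derived_exponent Pd) mulg1 expgMn //.
by apply: power_central; apply: (subgroupX _ A_subgroup).
Qed.

Let Z : set G := [set z | A z /\ forall x, A x -> commute z x].

Let Z_subgroup : subgroup Z.
Proof.
split.
  by split=> [|x _]; [exact: A_subgroup.1 | exact/commute_sym/commute1].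
move=> z w [Az zA] [Aw wA]; split; first exact: A_subgroup.2.
move=> x Ax; apply/commute_sym/commuteM; first exact/commute_sym/zA.
exact/commuteV/commute_sym/wA.
Qed.

Let Z_normal : normal Z.
Proof.
split=> // z y [Az zA]; split; first exact: A_normal.2.
move=> x Ax; rewrite -(conjgKV y x) /commute -!conjMg.
by rewrite (zA (x ^ y^-1)) //; apply: A_normal.2.
Qed.

Variable y : G.
Let delta z := [~ z, y].

Let delta_Z z : Z z -> Z (delta z).
Proof. exact: normal_commg. Qed.

Let iter_delta_Z i z : Z z -> Z (iter i delta z).
Proof. by move=> Zz; elim: i => //= i /delta_Z. Qed.

Let delta_expg z j : Z z -> delta (z ^+ j) = delta z ^+ j.
Proof.
move=> Zz; rewrite /delta !commgEl conjXg -expVgn -expgMn //.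
by apply: (subgroupV Z_subgroup Zz).2; exact: (Z_normal.2 _ _ Zz).1.
Qed.

Let iter_delta_expg i z j : Z z -> iter i delta (z ^+ j) = iter i delta z ^+ j.
Proof.
by move=> Zz; elim: i => //= i ->; rewrite delta_expg //; exact: iter_delta_Z.
Qed.

(** When [delta b] is fixed by [y], one has [b ^ (y ^+ j) = b * delta b ^+ j],
    whereas [y ^+ n`!] acts trivially. *)
Let delta2_torsion b : Z b -> delta (delta b) = 1 -> delta b ^+ n`! = 1.
Proof.
move=> Zb /eqP/conjg_fixP fixed.
have unip j : b ^ (y ^+ j) = b * delta b ^+ j.
  elim: j => [|j IH]; first by rewrite expg0 conjg1 mulg1.
  rewrite expgSr conjgM IH conjMg conjXg fixed expgS mulgA; congr (_ * _).
  by rewrite /delta commgEl mulVKg.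
have := power_central y Zb.1 => /commute_sym/commgP/conjg_fixP.
by rewrite unip -[in RHS](mulg1 b) => /mulgI.
Qed.

(** Applied to an iterate of [delta] at [z ^+ e], the previous fact removes one
    [delta] at the cost of a factor [n`!] in the exponent. *)
Let delta_torsion i z e : Z z -> iter i.+1 delta z ^+ e = 1 ->
  delta z ^+ (e * n`! ^ i)%N = 1.
Proof.
move=> Zz; elim: i e => [|i IH] e; first by rewrite expn0 muln1.
move=> ez; rewrite expnS mulnA; apply: IH.
rewrite expgnA -iter_delta_expg // iterS; apply: delta2_torsion.
  by apply: iter_delta_Z; apply: (subgroupX _ Z_subgroup).
by rewrite -2!iterS iter_delta_expg.
Qed.

(** As [Z] is abelian, [delta z = [y, z^-1]], so the iterates of [delta] on [Z]
    are commutators starting with [y]. *)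
Let commg_values_delta i z : Z z -> commg_values i.+1 y (iter i.+1 delta z).
Proof.
move=> Zz; exists [tuple of z^-1 :: nseq i y] => //=.
have -> : [~ y, z^-1] = delta z.
  rewrite -invgR commgEl invgK invgM -conjVg invgK; apply: esym.
  exact: (subgroupV Z_subgroup Zz).2 _ (Z_normal.2 _ _ Zz).1.
rewrite -iterS iterSr; elim: i (delta z) => //= i IH w.
by rewrite IH -iterSr.
Qed.

Lemma commg_torsion i :
    at_most n (commg_values i.+1 y) ->
  [~ g, y] ^+ (transfer_exp n * (n`! * n`! ^ i))%N = 1.
Proof.
move=> bounded; have Zg : Z (g ^+ M).
  split=> [|x Ax]; first exact: (subgroupX _ A_subgroup).
  rewrite /M /transfer_exp mulnC expgnA.
  exact: power_central.
rewrite expgnA.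
have -> : [~ g, y] ^+ transfer_exp n = delta (g ^+ M).
  rewrite /delta !commgEl expg_transferM ?expVgn ?conjXg //.
  exact: (subgroupV A_subgroup).
apply: delta_torsion => //; apply: (expg_fact_eq1 bounded) => j.
rewrite -iter_delta_expg //; apply: commg_values_delta.
exact: (subgroupX _ Z_subgroup).
Qed.

End FiniteClass.

(** * The upper central series modulo a normal subgroup *)

Section UpperCentral.
Variable G : groupType.
Implicit Types (N : set G) (u a x : G) (t : seq G).

Fixpoint upper_central N i : set G :=
  if i is j.+1 then [set x | forall y, upper_central N j [~ x, y]] else N.

Lemma upper_central_normal N i : normal N -> normal (upper_central N i).
Proof.
move=> nN; elim: i => // i [sU UJ]; split; first split=> [y|x z Ux Uz y].
- by rewrite comm1g; exact: sU.1.
- have -> : [~ x / z, y] = ([~ x, y] / [~ z, y]) ^ z^-1.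
    by rewrite /commg /conjg !invgM !invgK !mulgA !mulgK.
  by apply: UJ; apply: sU.2.
- by move=> x z Ux y; rewrite -{1}(conjgKV z y) -conjRg; apply: UJ.
Qed.

Lemma upper_centralP N i u :
  upper_central N i u <->
  forall t, size t = i -> N (lnormed_commg (u :: t)).
Proof.
elim: i u => [|i IH] u; first by split=> [Nu t /size0nil->|/(_ [::])]; last exact.
split=> [Uu [|x t] //= [st]|Nu x]; first exact: (IH _).1.
by apply: (IH _).2 => t st; apply: (Nu (x :: t)); rewrite /= st.
Qed.

(** Since [[u * a, x] = [u, x] ^ a * [a, x]], each further entry of the commutator
    lowers the factor coming from [u] by one step of the central series. *)
Lemma upper_central_mul N u a t : normal N -> upper_central N (size t) u ->
  N (lnormed_commg (u * a :: t) / lnormed_commg (a :: t)).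
Proof.
move=> nN; elim: t u a => [|x t IH] u a Uu; first by rewrite /= mulgK.
have commMg : [~ u * a, x] = [~ u, x] ^ a * [~ a, x].
  by rewrite /commg /conjg !invgM !mulgA !mulgK.
rewrite /= commMg; apply: IH.
by apply: (upper_central_normal _ nN).2; apply: Uu.
Qed.

End UpperCentral.

(** * The normal closures of the commutator values *)

Definition torsion_exp k n : nat := (transfer_exp n * (n`! * n`! ^ k))%N.

Definition closure_bound k n : nat := ((n * n).+1 ^ (n * n * torsion_exp k n))%N.

Section Main.
Variables (G : groupType) (k n : nat).
Hypothesis few : forall x : G, at_most n (commg_values k.+1 x).
Implicit Types (u a x y v : G) (t : seq G) (K : set G).

Let commg_valuesP u v :
  commg_values k.+1 u v <-> exists2 t, size t = k.+1 & v = lnormed_commg (u :: t).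
Proof.
split=> [[t _ <-]|[t st ->]]; first by exists t; rewrite ?size_tuple.
by exists (tcast st (in_tuple t)) => //; rewrite val_tcast.
Qed.

Let class_bound u t : size t = k ->
  at_most n [set lnormed_commg (u :: t) ^ y | y in [set: G]].
Proof.
move=> st; set v := lnormed_commg _.
apply: at_most_sub (at_most_image (fun w => v * w) (few u)) => // _ [y _ <-].
exists [~ v, y]; last by rewrite commgEl mulVKg.
apply/commg_valuesP; exists (rcons t y); first by rewrite size_rcons st.
by rewrite /= foldl_rcons.
Qed.

Let value_torsion u v : commg_values k.+1 u v -> v ^+ torsion_exp k n = 1.
Proof.
move=> /commg_valuesP[t st ->]; case/lastP: t st => [|t y] //.
rewrite size_rcons /= foldl_rcons => -[st].
exact: (commg_torsion (class_bound u st)).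
Qed.

Let N u := normal_closure (commg_values k.+1 u).

Let N_normal u : normal (N u) := normal_closure_normal _.

Let torsion_exp_gt0 : (0 < torsion_exp k n)%N.
Proof. by rewrite !muln_gt0 expn_gt0 !fact_gt0. Qed.

Let closure_bound_gt0 : (0 < closure_bound k n)%N.
Proof. by rewrite expn_gt0. Qed.

Let N_bounded u : at_most (closure_bound k n) (N u).
Proof.
set T := [set x | exists2 v, commg_values k.+1 u v & exists y, x = v ^ y].
have TN : at_most (n * n)%N T.
  have aF v : commg_values k.+1 u v -> at_most n [set v ^ y | y in [set: G]].
    move=> /commg_valuesP[[|x t] // [st] ->]; exact: class_bound st.
  apply: at_most_sub (at_most_bigcup (few u) aF) => // _ [v Vv [y ->]].
  by exists v => //; exists y.
have Te c : T c -> c ^+ torsion_exp k n = 1.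
  by move=> [v Vv [y ->]]; rewrite -conjXg (value_torsion Vv) conj1g.
apply: (@at_most_sub _ _ (prods T) (closure_bound k n)) => //.
  by apply: gen_min; [exact: prods_subgroup Te | exact: sub_prods].
apply: at_most_prods TN _.
  by move=> _ d [v Vv [y ->]] _; exists v => //; exists (y * d); rewrite conjgM.
by move=> c /Te ce; exists [::]; rewrite ?big_nil.
Qed.

Let N_min u K : normal K -> upper_central K k.+1 u -> N u `<=` K.
Proof.
move=> nK /upper_centralP uK; apply: normal_closure_min => //.
by move=> _ /commg_valuesP[t st ->]; apply: uK.
Qed.

Let N_upper u K : N u `<=` K -> upper_central K k.+1 u.
Proof.
move=> NK; apply/upper_centralP => t st; apply: NK; apply: normal_closure_sub.
by apply/commg_valuesP; exists t.
Qed.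

(** [[w, u]] is the inverse of [[u, w]], which lies in the subgroup
    [upper_central (N u) k]. *)
Let N_second u w t : size t = k -> N u (lnormed_commg (w :: u :: t)).
Proof.
move=> st; have /= := N_upper (@subset_refl _ (N u)) => /(_ w) Uuw.
have /upper_centralP : upper_central (N u) k [~ w, u].
  rewrite -invgR; apply: subgroupV => //.
  exact: (upper_central_normal _ (N_normal u)).1.
exact.
Qed.

Let adjoin K c (X : seq G) : normal K -> at_most c K ->
  exists K', [/\ normal K', at_most (c * closure_bound k n ^ size X)%N K',
                K `<=` K' & forall x, x \in X -> N x `<=` K'].
Proof.
move=> nK cK; elim: X => [|x X [L [nL cL KL XL]]].
  by exists K; split=> //; rewrite muln1.
exists (join L (N x)); split.
- exact: join_normal.
- by rewrite expnSr mulnA; apply: at_most_join.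
- by apply: subset_trans KL _; apply: join_subl; exact: (N_normal x).1.
- move=> y; rewrite inE => /orP[/eqP->|/XL yL]; first exact: join_subr nL.1.
  by apply: subset_trans yL _; apply: join_subl; exact: (N_normal x).1.
Qed.

(** What successive enlargements of [K] achieve: as long as [N u] is not absorbed,
    [j] counts elements that it shares with [K], which cannot go on beyond the
    order of [N u]. *)
Definition absorbed_or_meets j K u : Prop :=
  N u `<=` K \/
  exists s, [/\ uniq s, size s = j & forall x, x \in s -> N u x /\ K x].

(** One round of enlargement, everything being taken modulo [K]: [a] is chosen so
    that [join (N a) K] is maximal, and [K'] is generated by [K] and the [N x],
    for [x] ranging over second entries that suffice to express all values
    starting with [a]. If [N u] meets [K'] only inside [K], then multiplying [a]
    by [u] does not change these values modulo [K], and maximality forces [N u]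
    into [K']. *)
Let enlarge K c j :
    normal K -> at_most c K -> (forall u, absorbed_or_meets j K u) ->
  exists K', [/\ normal K', at_most (c * closure_bound k n ^ n)%N K'
                & forall u, absorbed_or_meets j.+1 K' u].
Proof.
move=> nK cK meets.
have [a amax] := maximal_exists (1 : G) (fun u => at_most_join (N_bounded u) cK).
have [l ln lV] := few a.
have /choice[first firstP] v : exists x, commg_values k.+1 a v ->
    exists2 t, size t = k & v = lnormed_commg (a :: x :: t).
  case: (pselect (commg_values k.+1 a v)) => [/commg_valuesP|]; last by exists 1.
  by move=> [[|x t] // [st] ->]; exists x => _; exists t.
have [K' [nK' cK' KK' XK']] := adjoin (map first l) nK cK.
have firstK v : commg_values k.+1 a v -> N (first v) `<=` K'.
  by move=> Vv; apply: XK'; apply/map_f/lV.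
have VK' : commg_values k.+1 a `<=` K'.
  move=> v Vv; have [t st ->] := firstP v Vv.
  by apply: (firstK v Vv); exact: N_second.
exists K'; split=> [//||u].
  apply: at_most_sub cK' => //; rewrite leq_mul2l leq_pexp2l ?orbT // size_map //.
case: (pselect (N u `&` K' `<=` K)) => [NK'|]; last first.
  case: (meets u) => [NK|[s [us sj sNK]]].
    by left; apply: subset_trans KK'.
  move=> /existsNP[x /not_implyP[[Nx K'x] nKx]]; right; exists (x :: s); split.
  - by rewrite /= us andbT; apply/negP => /sNK[].
  - by rewrite /= sj.
  - by move=> y; rewrite inE => /orP[/eqP->|/sNK[Ny /KK']].
left; have Nua : join (N a) K `<=` join (N (u * a)) K.
  have nJ := join_normal (N_normal (u * a)) nK.
  apply: join_min; [exact: nJ.1 | | exact: join_subr (N_normal _).1].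
  apply: normal_closure_min => // v Vv.
  have [t st ev] := firstP v Vv; pose w := lnormed_commg (u * a :: first v :: t).
  have Kwv : K (w / v).
    apply: NK'; split; last first.
      apply: nK'.1.2; last exact: VK'.
      by apply: (firstK v Vv); exact: N_second.
    rewrite ev; apply: upper_central_mul => //.
    by rewrite /= st; apply: N_upper.
  have -> : v = (w / v)^-1 * w by rewrite invgF mulgVK.
  apply: subgroupM nJ.1 _ _.
    apply: subgroupV nJ.1 _; exact: join_subr (N_normal _).1 _ Kwv.
  apply: join_subl nK.1 _ _; apply: normal_closure_sub; apply/commg_valuesP.
  by exists (first v :: t); rewrite /= ?st.
have nJ := join_normal (N_normal a) nK.
have aJ : N a `<=` join (N a) K by apply: join_subl; exact: nK.1.
have uJ : upper_central (join (N a) K) k.+1 u.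
  rewrite -(mulgK a u).
  apply: (upper_central_normal _ nJ).1.2; apply: N_upper => //.
  by apply: subset_trans (amax _ Nua); apply: join_subl; exact: nK.1.
apply: subset_trans (N_min nJ uJ) _; apply: join_min => //; first exact: nK'.1.
exact: normal_closure_min.
Qed.

Lemma lower_central_at_most :
  at_most (closure_bound k n ^ (n * closure_bound k n))%N (lower_central G k.+2).
Proof.
set B := closure_bound k n.
have chain j : exists K, [/\ normal K, at_most (B ^ (n * j))%N K
                           & forall u, absorbed_or_meets j.+1 K u].
  elim: j => [|j [K [nK cK meets]]].
    (* The trivial subgroup shares the element [1] with every [N u]. *)
    exists [set 1]; split.
    - split; first by split=> // x y -> ->; rewrite invg1 mulg1.
      by move=> x y ->; rewrite /mkset conj1g.
    - by exists [:: 1] => [|x ->]; rewrite ?muln0 ?mem_seq1.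
    - move=> u; right; exists [:: 1]; split=> // x; rewrite mem_seq1 => /eqP->.
      by split=> //; exact: (N_normal u).1.1.
  have [K' [nK' cK' meets']] := enlarge nK cK meets; exists K'; split=> //.
  by rewrite mulnSr expnD.
(* [N u] has at most [B] elements, so it cannot share [B.+1] elements with
   [K]: the first alternative holds for every [u]. *)
have [K [nK cK meets]] := chain B.
apply: at_most_sub cK => //; apply: gen_min; first exact: nK.1.
move=> _ [[[|u t] //] st _ <-].
have NK : N u `<=` K.
  case: (meets u) => // -[s [us sB sN]].
  have := at_most_uniq (N_bounded u) us (fun x xs => (sN x xs).1).
  by rewrite sB ltnn.
apply: NK; apply: normal_closure_sub; apply/commg_valuesP; exists t => //.
by move/eqP: st => [].
Qed.

End Main.

Theorem theorem1p1 :
  exists f : nat -> nat -> nat,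
    (forall k n : nat, 0 < k -> 0 < n -> 0 < f k n) /\
    forall (k n : nat) (G : groupType),
      0 < k -> 0 < n ->
      (forall x : G, (commg_values k x #<= `I_n)%card) ->
      finite_set (lower_central G k.+1) /\
      (lower_central G k.+1 #<= `I_(f k n))%card.
Proof.
pose B k n := closure_bound k.-1 n.
(* The bounds are indexed by [k - 1], for commutators of weight [k + 1]. *)
exists (fun k n => B k n ^ (n * B k n))%N; split=> [k n _ _|].
  by rewrite !expn_gt0.
move=> [|k] // n G _ _ few.
have := lower_central_at_most (fun x => card_le_at_most (few x)).
move=> /at_most_card_le bounded; split=> //.
exact: card_le_finite bounded (finite_II _).
Qed.
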